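(* Let $\gamma>0$, let $u^{\min}\le u^{\max}$, and let $G=[u^{\min},u^{\max}]^{N_h}$. Consider the flux-corrected semi-discrete scheme $$|K_i|\frac{\mathrm d u_i}{\mathrm dt}=d_i(\bar u_i^*-u_i),\qquad \bar u_i^*=\bar u_i^L+\frac1{d_i}\sum_{j\in\mathcal N_i}F_{ij}^*,\qquad i=1,\ldots,N_h,$$ where the fluxes $F_{ij}^*=F_{ij}^*(u)$ are such that, for all $u\in G$ and all $i$, $$(1+\gamma)(u_i^{\min}-u_i)\le \bar u_i^*-u_i\le(1+\gamma)(u_i^{\max}-u_i).$$ Assume that the $\lambda_{ij}$ are uniformly bounded on $G$ and that the system of ordinary differential equations has a unique solution for all $t>0$ for every initial value in $G$. Then the scheme is bound preserving with respect to $[u^{\min},u^{\max}]$: if $u_i(0)\in[u^{\min},u^{\max}]$ for all $i$, then $u_i(t)\in[u^{\min},u^{\max}]$ for all $i$ and all $t>0$.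
   Context: The scheme discretizes the scalar conservation law $\partial_t u+\nabla\cdot\mathbf f(u)=0$ with (continuously differentiable) flux $\mathbf f:\mathbb R\to\mathbb R^d$, $d\in\{1,2,3\}$, on a hyperrectangle with periodic boundary conditions, partitioned into finitely many cells $K_1,\ldots,K_{N_h}$ of volume $|K_i|>0$. $\mathcal N_i$ is the (nonempty) set of indices $j\ne i$ of cells sharing a face $S_{ij}=\partial K_i\cap\partial K_j$ of positive area $|S_{ij}|$ with $K_i$; $\mathbf n_{ij}=-\mathbf n_{ji}$ is the constant unit normal on $S_{ij}$ pointing out of $K_i$. $\mathcal V_i$ is the set containing $i$ and the indices of all cells that share a vertex with $K_i$ (so $\mathcal N_i\subset\mathcal V_i$). The unknown $u=(u_1,\ldots,u_{N_h})$ is the vector of cell averages. $\lambda_{ij}=\lambda_{ji}>0$ (possibly depending on $u$) is an upper bound for the wave speed of the Riemann problem associated with $S_{ij}$, i.e. $|\mathbf f'(v)\cdot\mathbf n_{ij}|\le\lambda_{ij}$ for all $v$ between $u_i$ and $u_j$. Set $$\bar u_{ij}^L=\frac{u_j+u_i}{2}-\frac{\mathbf f(u_j)-\mathbf f(u_i)}{2\lambda_{ij}}\cdot\mathbf n_{ij},\qquad d_i=\sum_{j\in\mathcal N_i}|S_{ij}|\lambda_{ij},\qquad \bar u_i^L=\frac1{d_i}\sum_{j\in\mathcal N_i}|S_{ij}|\lambda_{ij}\bar u_{ij}^L.$$ The numbers $u_i^{\min},u_i^{\max}$ (possibly depending on $u$) are (global or local) bounds satisfying, for $u\in G$, $$u^{\min}\le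 u_i^{\min}\le\min_{j\in\mathcal V_i}u_j\le u_i\le\max_{j\in\mathcal V_i}u_j\le u_i^{\max}\le u^{\max}.$$
   Formalization: The formal theorem additionally assumes that the right-hand sides d_i(ū_i^* − u_i) of the ODE system are continuous on G; without this the claim fails, since a discontinuous flux F* can give unique solutions that leave G. *)

(* Defs.v *)
From HB Require Import structures.
From mathcomp Require Import all_boot all_order all_algebra.
From mathcomp Require Import all_classical all_reals all_analysis.

Set Implicit Arguments.
Unset Strict Implicit.
Unset Printing Implicit Defensive.
Import Order.TTheory GRing.Theory Num.Theory.
Import numFieldNormedType.Exports.
Local Open Scope classical_set_scope.
Local Open Scope ring_scope.

(* Euclidean inner product: the library norm on 'rV[R]_d is the sup norm. *)
Definition dotp (R : realType) (d : nat) (a b : 'rV[R]_d) : R :=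
  \sum_(k < d) a 0 k * b 0 k.

(* The data of a partition of a periodic d-dimensional box into N cells that
   the scheme refers to.  The geometry enters only through the volumes |K_i|,
   the areas |S_ij|, the unit normals n_ij and the incidence of cells and mesh
   vertices, so no realization of the cells as subsets of the torus is required:
   every actual periodic mesh yields such a record.  A pair of cells without a
   common face of positive area is encoded by area i j = 0; the value of
   normal i j is then irrelevant. *)
Record periodic_mesh (R : realType) (d N : nat) := PeriodicMesh {
  mesh_vertex : finType;
  cell_vertices : 'I_N -> {set mesh_vertex};
  vol : 'I_N -> R;
  area : 'I_N -> 'I_N -> R;
  normal : 'I_N -> 'I_N -> 'rV[R]_d;
  vol_gt0 : forall i, 0 < vol i;
  area_ge0 : forall i j, 0 <= area i j;
  area_sym : forall i j, area i j = area j i;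
  has_neighbor : forall i, exists j, (j != i) && (0 < area i j);
  normal_unit : forall i j, j != i -> 0 < area i j ->
    dotp (normal i j) (normal i j) = 1;
  normal_opp : forall i j, j != i -> 0 < area i j ->
    normal i j = - normal j i;
  face_share_vertex : forall i j, j != i -> 0 < area i j ->
    exists p, p \in cell_vertices i :&: cell_vertices j
}.

Definition neighbors (R : realType) (d N : nat) (K : periodic_mesh R d N)
    (i : 'I_N) : {set 'I_N} :=
  [set j : 'I_N | (j != i) && (0 < area K i j)]%SET.

Definition vertex_neighbors (R : realType) (d N : nat)
    (K : periodic_mesh R d N) (i : 'I_N) : {set 'I_N} :=
  [set j : 'I_N | (j == i)
     || [exists p, p \in cell_vertices K i :&: cell_vertices K j]]%SET.

(* The seed u_i is harmless since i belongs to vertex_neighbors K i. *)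
Definition local_min (R : realType) (d N : nat) (K : periodic_mesh R d N)
    (u : 'rV[R]_N) (i : 'I_N) : R :=
  \big[Num.min/u 0 i]_(j in vertex_neighbors K i) u 0 j.

Definition local_max (R : realType) (d N : nat) (K : periodic_mesh R d N)
    (u : 'rV[R]_N) (i : 'I_N) : R :=
  \big[Num.max/u 0 i]_(j in vertex_neighbors K i) u 0 j.

Definition flux_C1 (R : realType) (d : nat) (f : R -> 'rV[R]_d) : Prop :=
  forall k : 'I_d, (forall x, derivable (fun y => f y 0 k) x 1)
    /\ continuous (derive1 (fun y => f y 0 k)).

Definition flux_deriv (R : realType) (d : nat) (f : R -> 'rV[R]_d) (v : R)
    : 'rV[R]_d :=
  \row_(k < d) derive1 (fun y => f y 0 k) v.

Definition wave_speed_bound (R : realType) (d N : nat)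
    (K : periodic_mesh R d N) (f : R -> 'rV[R]_d)
    (lam : 'rV[R]_N -> 'I_N -> 'I_N -> R) : Prop :=
  forall (u : 'rV[R]_N) (i j : 'I_N), j \in neighbors K i ->
    [/\ 0 < lam u i j,
        lam u i j = lam u j i
      & forall v : R,
          Num.min (u 0 i) (u 0 j) <= v <= Num.max (u 0 i) (u 0 j) ->
          `|dotp (flux_deriv f v) (normal K i j)| <= lam u i j].

Definition bar_state (R : realType) (d N : nat) (K : periodic_mesh R d N)
    (f : R -> 'rV[R]_d) (lam : 'rV[R]_N -> 'I_N -> 'I_N -> R)
    (u : 'rV[R]_N) (i j : 'I_N) : R :=
  (u 0 j + u 0 i) / 2
  - dotp ((2 * lam u i j)^-1 *: (f (u 0 j) - f (u 0 i))) (normal K i j).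

Definition diff_coef (R : realType) (d N : nat) (K : periodic_mesh R d N)
    (lam : 'rV[R]_N -> 'I_N -> 'I_N -> R) (u : 'rV[R]_N) (i : 'I_N) : R :=
  \sum_(j in neighbors K i) area K i j * lam u i j.

Definition bar_low (R : realType) (d N : nat) (K : periodic_mesh R d N)
    (f : R -> 'rV[R]_d) (lam : 'rV[R]_N -> 'I_N -> 'I_N -> R)
    (u : 'rV[R]_N) (i : 'I_N) : R :=
  (diff_coef K lam u i)^-1 *
  \sum_(j in neighbors K i) area K i j * lam u i j * bar_state K f lam u i j.

Definition bar_corrected (R : realType) (d N : nat) (K : periodic_mesh R d N)
    (f : R -> 'rV[R]_d) (lam F : 'rV[R]_N -> 'I_N -> 'I_N -> R)
    (u : 'rV[R]_N) (i : 'I_N) : R :=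
  bar_low K f lam u i
  + (diff_coef K lam u i)^-1 * \sum_(j in neighbors K i) F u i j.

Definition scheme_rhs (R : realType) (d N : nat) (K : periodic_mesh R d N)
    (f : R -> 'rV[R]_d) (lam F : 'rV[R]_N -> 'I_N -> 'I_N -> R)
    (u : 'rV[R]_N) (i : 'I_N) : R :=
  diff_coef K lam u i * (bar_corrected K f lam F u i - u 0 i).

(* vol_i u_i' = d_i (ubar_i^* - u_i) for t > 0, u continuous on [0, +oo) and
   u(0) = u0; values of u at negative times are irrelevant.  Trajectories are
   not confined to any admissible set. *)
Definition scheme_solution (R : realType) (d N : nat) (K : periodic_mesh R d N)
    (f : R -> 'rV[R]_d) (lam F : 'rV[R]_N -> 'I_N -> 'I_N -> R)
    (u0 : 'rV[R]_N) (u : R -> 'rV[R]_N) : Prop :=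
  [/\ u 0 = u0,
      {within `[0, +oo[, continuous u}
    & forall (t : R) (i : 'I_N), 0 < t ->
        derivable (fun s => u s 0 i) t 1 /\
        vol K i * derive1 (fun s => u s 0 i) t = scheme_rhs K f lam F (u t) i].

Definition admissible (R : realType) (N : nat) (lo hi : R) : set 'rV[R]_N :=
  [set u | forall i, lo <= u 0 i <= hi].
Arguments admissible {R} N lo hi.

(* Main.v *)
(** The right-hand side is controlled only on the compact box G, so the given
    solution cannot be estimated directly once it leaves G.  Instead, a solution
    that stays in G is constructed and uniqueness identifies it with the given one.
    The bounds on ubar_i^* - u_i and on d_i / |K_i| make every sufficiently
    short explicit Euler step map G into itself.  Piecewise constant Euler
    interpolants with step tending to 0 therefore take values in G, and their
    pointwise limit along an ultrafilter on nat exists by compactness.  Passing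
    to the limit in increments of the Euler nodes shows that this limit is
    Lipschitz and solves the system, without any Arzela-Ascoli or integral
    argument. *)
Require Import Defs.
From HB Require Import structures.
From mathcomp Require Import all_boot all_order all_algebra.
From mathcomp Require Import all_classical all_reals all_analysis.
From mathcomp Require Import lra.
Import Order.TTheory GRing.Theory Num.Theory.
Import numFieldNormedType.Exports.
Local Open Scope classical_set_scope.
Local Open Scope ring_scope.

(** * Limits along an ultrafilter and convergence of time grids *)

(** Compactness gives a cluster point. An ultrafilter contains the preimage of each neighborhood or
    its complement, and clustering excludes the complement, so the cluster point is a limit. *)
Lemma ultra_cvg_compact {T : Type} {V : topologicalType} (U : set_system T)
    (A : set V) (f : T -> V) :
  UltraFilter U -> compact A -> (forall n, A (f n)) ->
  exists2 p, A p & f n @[n --> U] --> p.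
Proof.
move=> UU cA Af.
have [p [Ap clp]] : A `&` cluster (f @ U) !=set0.
  by apply: cA; exact: nearW.
exists p => // B pB.
have [//|UfB] := in_ultra_setVsetC (f @^-1` B) UU.
by have [z []] := clp (~` B) B UfB pB.
Qed.

Lemma cvg_grid {R : realType} {U : set_system nat} {FU : Filter U}
    (h : nat -> R) (t : R) : 0 <= t -> (forall n, 0 < h n) ->
  h n @[n --> U] --> 0 ->
  h n * (Num.truncn (t / h n))%:R @[n --> U] --> t.
Proof.
move=> t0 h0 cvgh; apply/cvgrPdist_le => e e0.
have := cvgr_norm_le 0 cvgh e; rewrite normr0 => /(_ _ e0).
apply: filterS => n; rewrite gtr0_norm // => hne; apply: le_trans hne.
have /truncn_itv/andP[] : 0 <= t / h n by rewrite divr_ge0 // ltW.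
rewrite ler_pdivlMr // ltr_pdivrMr // -natr1 mulrDl mul1r !(mulrC _ (h n)).
by move=> /[!ler_norml]; set k := h n * _; lra.
Qed.

(** * Explicit Euler iterates and increment estimates *)

Definition euler {R : realType} {V : normedModType R} (g : V -> V) (x : V)
    (h : R) (k : nat) : V :=
  iter k (fun y => y + h *: g y) x.

(** A discrete mean value inequality: each step contributes an error [h *: (g a - v)] of norm at
    most [h * e]. The choice [v = 0] gives Lipschitz bounds; a slope [v] close to the field gives
    the derivative. *)
Lemma euler_increment {R : realType} {V : normedModType R} (g : V -> V)
    (x v : V) (h e : R) (k m : nat) : 0 <= h -> (k <= m)%N ->
  (forall l, (k <= l < m)%N -> `|g (euler g x h l) - v| <= e) ->
  `|euler g x h m - euler g x h k - (h * m%:R - h * k%:R) *: v|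
    <= e * (h * m%:R - h * k%:R).
Proof.
move=> h0 /subnK <-; elim: (m - k)%N => [|p IHp] Hl.
  by rewrite add0n !subrr scale0r mulr0 subr0 normr0.
rewrite addSn [euler g x h _.+1]/= -/(euler g x h (p + k)).
rewrite -natr1 mulrDr mulr1.
set a := euler g x h (p + k) in IHp *; set b := euler g x h k in IHp *.
set r := h * (p + k)%:R in IHp *; set s := h * k%:R in IHp *.
rewrite [r + h - s]addrAC.
have -> : a + h *: g a - b - (r - s + h) *: v
    = (a - b - (r - s) *: v) + h *: (g a - v).
  rewrite scalerBr scalerDl opprD [a + _ - b]addrAC.
  by rewrite addrACA.
apply: le_trans (ler_normD _ _) _.
have -> : e * (r - s + h) = e * (r - s) + h * e by lra.
rewrite lerD //.
  by apply: IHp => l /andP[kl lm]; apply: Hl; rewrite kl addSn ltnW.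
rewrite normrZ ger0_norm // ler_wpM2l //.
by apply: Hl; rewrite leq_addl addSn ltnS leqnn.
Qed.

Definition euler_step {R : realType} {V : normedModType R} (g : V -> V) (x : V)
    (h t : R) : V :=
  euler g x h (Num.truncn (t / h)).

(** The nodes below [s] and [t] converge to [s] and [t], so the discrete estimate, a closed
    condition, survives the limit along [U]. *)
Lemma euler_limit_increment {R : realType} {V : normedModType R}
    {U : set_system nat} {FU : ProperFilter U} (h : nat -> R) (g : V -> V)
    (x v : V) (w : R -> V) (s t e : R) :
  (forall n, 0 < h n) -> h n @[n --> U] --> 0 ->
  (forall r, euler_step g x (h n) r @[n --> U] --> w r) ->
  0 <= s <= t ->
  (\forall n \near U, forall l : nat,
    (Num.truncn (s / h n) <= l < Num.truncn (t / h n))%N ->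
    `|g (euler g x (h n) l) - v| <= e) ->
  `|w t - w s - (t - s) *: v| <= e * (t - s).
Proof.
move=> h0 cvgh cvgw /andP[s0 st] near_v.
pose D n := h n * (Num.truncn (t / h n))%:R - h n * (Num.truncn (s / h n))%:R.
have cvgD : D n @[n --> U] --> t - s.
  by apply: cvgB; apply: cvg_grid => //; exact: le_trans st.
rewrite -subr_ge0.
pose E n := e * D n
  - `|euler_step g x (h n) t - euler_step g x (h n) s - D n *: v|.
have E_ge0 : \forall n \near U, 0 <= E n.
  apply: filterS near_v => n Hn; rewrite /E subr_ge0.
  apply: euler_increment => //; first exact/ltW.
  by apply: le_truncn; rewrite ler_wpM2r // invr_ge0 ltW.
apply: (closed_cvg (fun z : R => 0 <= z) (@closed_ge R 0) E_ge0).
apply: cvgB; first exact: cvgMl_tmp.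
by apply: cvg_norm; apply: cvgB; [exact: cvgB | exact: cvgZr_tmp].
Qed.

Lemma euler_lipschitz {R : realType} {V : normedModType R} (g : V -> V)
    (x : V) (h L : R) (k l : nat) : 0 <= h ->
  (forall n, `|g (euler g x h n)| <= L) ->
  `|euler g x h k - euler g x h l| <= L * `|h * k%:R - h * l%:R|.
Proof.
move=> h0 gL; wlog lk : k l / (l <= k)%N => [wl|].
  have [|/ltnW] := leqP l k; first exact: wl.
  by rewrite distrC [X in L * X]distrC; exact: wl.
have := @euler_increment _ _ g x 0 h L l k h0 lk.
rewrite scaler0 subr0 ger0_norm ?subr_ge0 ?ler_wpM2l ?ler_nat //.
by apply => n _; rewrite subr0.
Qed.

Lemma is_derive_of_increment {R : realType} {V : normedModType R}
    (w : R -> V) (t : R) (v : V) : 0 < t ->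
  (forall e, 0 < e -> exists2 dl, 0 < dl & forall a b : R, 0 <= a <= b ->
    `|a - t| <= dl -> `|b - t| <= dl ->
    `|w b - w a - (b - a) *: v| <= e * (b - a)) ->
  is_derive t 1 w v.
Proof.
move=> t0 Hw.
suff cv : h^-1 *: ((w \o shift t) (h *: 1) - w t) @[h --> 0^'] --> v.
  by apply: DeriveDef; [apply/cvg_ex; exists v | exact: cvg_lim cv].
apply/cvgrPdist_le => e e0; have [dl dl0 {}Hw] := Hw e e0.
near=> h.
have h0 : h != 0 by near: h; exact: nbhs_dnbhs_neq.
have hdl : `|h| < dl by near: h; exact: dnbhs0_lt.
(* This keeps [h + t] nonnegative, where the increment estimate is available. *)
have ht : `|h| < t by near: h; exact: dnbhs0_lt.
rewrite /= /shift /= [h *: 1]mulr1.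
have -> : v - h^-1 *: (w (h + t) - w t)
    = - (h^-1 *: (w (h + t) - w t - h *: v)).
  by rewrite [in RHS]scalerBr scalerA mulVf // scale1r opprB.
rewrite normrN normrZ normfV ler_pdivrMl ?normr_gt0 // [leRHS]mulrC.
(* The first case is [h < 0], with interval from [h + t] to [t]; the second is [h > 0], with
   interval from [t] to [h + t]. *)
have [hpos|hneg|] := ltgtP h 0; last by move/eqP; rewrite (negPf h0).
- have := Hw (h + t) t; rewrite addrK (_ : t - (h + t) = - h); last by lra.
  rewrite scaleNr opprK subrr normr0 -(normrN (_ + h *: v)) opprD opprB.
  by rewrite ltr0_norm // in hdl ht *; apply; lra.
- have := Hw t (h + t); rewrite addrK subrr normr0.
  by rewrite gtr0_norm // in hdl ht *; apply; lra.
Unshelve. all: by end_near. Qed.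

(** * Existence of a solution that stays in a compact set *)

Lemma viable_ode_solution {R : realType} {V : normedModType R} (A : set V)
    (g : V -> V) (H : R) : 0 < H -> compact A -> {within A, continuous g} ->
  (forall (x : V) (h : R), A x -> 0 <= h <= H -> A (x + h *: g x)) ->
  forall x : V, A x -> exists w : R -> V,
    [/\ w 0 = x, forall t, A (w t), {within `[0, +oo[, continuous w}
      & forall t : R, 0 < t -> is_derive t 1 w (g (w t))].
Proof.
move=> H0 cA cg stable x Ax.
have [L L0 gL] : exists2 L, 0 < L & forall y, A y -> `|g y| <= L.
  have /compact_bounded/pinfty_ex_gt0[L L0 gL] := continuous_compact cg cA.
  by exists L => // y Ay; apply: gL; exists y.
pose h n : R := H * n.+1%:R^-1.
have h0 n : 0 < h n by rewrite mulr_gt0.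
have hH n : h n <= H by rewrite ger_pMr // invf_le1 // ler1n.
have Aeuler n k : A (euler g x (h n) k).
  by elim: k => //= k Ak; apply: stable => //; rewrite ltW //= hH.
(* One ultrafilter serves all times at once, so no diagonal subsequence is extracted. *)
have [U [UU nU]] := ultraFilterLemma eventually_filter.
have cvgh : h n @[n --> U] --> 0.
  apply: cvg_trans (_ : h n @[n --> \oo] --> 0); first exact: cvg_app.
  by rewrite -(mulr0 H); apply: cvgMl_tmp; exact: cvg_harmonic.
have /choice[w wP] : forall t : R, exists p,
    A p /\ euler_step g x (h n) t @[n --> U] --> p.
  move=> t; have [//|p Ap cp] := @ultra_cvg_compact _ _ U A
    (fun n => euler_step g x (h n) t) UU cA.
    by move=> n; exact: Aeuler.
  by exists p.
have Aw t := (wP t).1; have cvgw t := (wP t).2.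
have PU : ProperFilter U by exact: ultra_proper.
have increment v s t e :=
  @euler_limit_increment _ _ U PU h g x v w s t e h0 cvgh cvgw.
exists w; split => //.
- have := cvgw 0; rewrite /euler_step.
  under eq_fun do rewrite mul0r truncn0.
  by move=> /cvg_lim <- //; rewrite lim_cst.
(* The increment estimate with slope 0 and error [L]. *)
- have lip s t : 0 <= s <= t -> `|w t - w s| <= L * (t - s).
    move=> st; have := increment 0 s t L st; rewrite scaler0 subr0; apply.
    by apply: nearW => n l _; rewrite subr0 gL.
  apply/subspace_continuousP => t; rewrite /= in_itv /= andbT => t0.
  apply/cvgrPdist_le => e e0; rewrite near_withinE; near=> s.
  rewrite /= in_itv /= andbT => s0.
  have : `|t - s| <= e / L.
    by near: s; apply: cvgr_dist_le; [exact: cvg_id | rewrite divr_gt0].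
  rewrite ler_pdivlMr // mulrC; apply: le_trans.
  have [st|/ltW ts] := lerP s t.
    by rewrite lip // s0.
  by rewrite distrC lip // t0.
- move=> t t0; apply: is_derive_of_increment => // e e0.
  have /subspace_continuousP/(_ _ (Aw t))/cvgrPdist_le/(_ e e0) := cg.
  rewrite near_withinE => /nbhs_ballP[r /= r0 gr].
  (* Error budget: the interpolant at [t] is within [r / 4] of [w t]; the nodes between [a] and [b]
     are within [r / 4 / L] plus one step of the node of [t], hence Euler values differ by at most
     [r / 4 + r / 4]. The total stays below [r], where [g] is [e]-close to [g (w t)]. *)
  exists (r / 4 / L) => [|a b ab adl bdl]; first by rewrite !divr_gt0.
  have rL0 : 0 < r / 4 / L by rewrite !divr_gt0.
  have near_h : \forall n \near U, h n <= r / 4 / L.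
    have := cvgr_norm_le 0 cvgh (r / 4 / L); rewrite normr0 => /(_ _ rL0).
    by apply: filterS => n; rewrite gtr0_norm.
  have near_w := cvgr_dist_lt _ _ (cvgw t) (r / 4) (divr_gt0 r0 (ltr0Sn _ _)).
  apply: increment => //; near=> n.
  have hr : L * h n <= r / 4.
    by rewrite mulrC -ler_pdivlMr //; near: n; exact: near_h.
  have wr : `|w t - euler_step g x (h n) t| < r / 4.
    by near: n; exact: near_w.
  move=> l /andP[al lb]; rewrite distrC; apply: gr => //.
  rewrite -ball_normE /=.
  apply: (le_lt_trans (ler_distD (euler_step g x (h n) t) _ _)).
  suff close : `|euler_step g x (h n) t - euler g x (h n) l| <= r / 4 + r / 4.
    by lra.
  apply: le_trans (euler_lipschitz _ _ _ L _ _ (ltW (h0 n)) _) _.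
    by move=> k; exact: gL.
  have [a0 ale] := andP ab.
  have grid c : 0 <= c ->
      h n * (Num.truncn (c / h n))%:R <= c < h n * (Num.truncn (c / h n)).+1%:R.
    move=> c0; have /truncn_itv : 0 <= c / h n by rewrite divr_ge0 // ltW.
    by rewrite ler_pdivlMr // ltr_pdivrMr // ![_ * h n]mulrC.
  have ge_l : h n * (Num.truncn (a / h n))%:R <= h n * l%:R.
    by rewrite ler_pM2l // ler_nat.
  have lt_l : h n * l.+1%:R <= h n * (Num.truncn (b / h n))%:R.
    by rewrite ler_pM2l // ler_nat.
  have := grid _ (ltW t0); have := grid _ a0; have := grid _ (le_trans a0 ale).
  set q := r / 4 in hr adl bdl *; set dl := q / L in adl bdl.
  move: adl bdl ge_l lt_l; rewrite !ler_norml -!natr1 !mulrDr !mulr1.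
  move=> adl bdl ge_l lt_l gb ga gt.
  have : `|h n * (Num.truncn (t / h n))%:R - h n * l%:R| <= dl + h n.
    by rewrite ler_norml; have := h0 n; lra.
  rewrite -(ler_pM2l L0) mulrDr [L * dl]mulrC /dl divfK ?gt_eqF //.
  by move/le_trans; apply; rewrite lerD2l.
Unshelve. all: by end_near. Qed.

(** * The scheme as a vector field on the box and its stability under Euler steps *)

Lemma compact_admissible {R : realType} (N : nat) (lo hi : R) :
  compact (admissible N lo hi).
Proof.
have -> : admissible N lo hi = 
    [set u : 'rV[R]_N | forall i, `[lo, hi]%classic (u ord0 i)].
  by apply/seteqP; split=> u Hu i; have := Hu i; rewrite /= in_itv.
apply: (@rV_compact R N (fun=> `[lo, hi]%classic)) => _.
exact: segment_compact.
Qed.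

Lemma cvg_row {R : topologicalType} {T : Type} {F : set_system T}
    {FF : Filter F} {N : nat} (g : T -> 'I_N -> R) (l : 'I_N -> R) :
  (forall i, g x i @[x --> F] --> l i) ->
  \row_i g x i @[x --> F] --> \row_i l i.
Proof.
move=> cg B [P nP PB].
have : \forall x \near F, forall i, P ord0 i (g x i).
  by apply: filter_forall => i; apply: cg; have := nP ord0 i; rewrite mxE.
by apply: filterS => x Px; apply: PB => k i; rewrite ord1 mxE.
Qed.

Definition scheme_field {R : realType} {d N : nat} (K : periodic_mesh R d N)
    (f : R -> 'rV[R]_d) (lam F : 'rV[R]_N -> 'I_N -> 'I_N -> R)
    (u : 'rV[R]_N) : 'rV[R]_N :=
  \row_i ((vol K i)^-1 * scheme_rhs K f lam F u i).

Lemma diff_coef_ge0 {R : realType} {d N : nat} (K : periodic_mesh R d N)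
    (lam : 'rV[R]_N -> 'I_N -> 'I_N -> R) (u : 'rV[R]_N) (i : 'I_N) :
  (forall j, j \in neighbors K i -> 0 < lam u i j) ->
  0 <= diff_coef K lam u i.
Proof.
by move=> l0; apply: sumr_ge0 => j /l0/ltW; exact/mulr_ge0/area_ge0.
Qed.

Lemma diff_coef_bounded {R : realType} {d N : nat} (K : periodic_mesh R d N)
    (lam : 'rV[R]_N -> 'I_N -> 'I_N -> R) (A : set 'rV[R]_N) (M : R) :
  (forall u i j, A u -> j \in neighbors K i -> lam u i j <= M) ->
  exists2 C, 0 < C &
    forall u i, A u -> (vol K i)^-1 * diff_coef K lam u i <= C.
Proof.
move=> lamM.
have term_ge0 i : 0 <= (vol K i)^-1 * \sum_j area K i j * `|M|.
  rewrite mulr_ge0 ?invr_ge0 ?(ltW (vol_gt0 K i)) // sumr_ge0 // => j _.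
  by rewrite mulr_ge0 ?area_ge0.
(* The absolute value makes every summand nonnegative, so each is bounded by the sum; the 1 makes
   the constant positive even if the sum vanishes. *)
exists (1 + \sum_i (vol K i)^-1 * \sum_j area K i j * `|M|).
  by rewrite ltr_pwDl // sumr_ge0.
move=> u i Au; rewrite (bigD1 i) //= addrCA -[leLHS]addr0 lerD //; last first.
  by rewrite addr_ge0 // sumr_ge0.
rewrite ler_wpM2l ?invr_ge0 ?(ltW (vol_gt0 K i)) // /diff_coef big_mkcond /=.
apply: ler_sum => j _; case: ifP => [ij|_]; last by rewrite mulr_ge0 ?area_ge0.
rewrite ler_wpM2l ?area_ge0 //.
exact: le_trans (lamM _ _ _ Au ij) (ler_norm _).
Qed.

(** The distance of the new value to [lo] is at least [(1 - r * c) * (x - lo)], which is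
    nonnegative; likewise for [hi]. *)
Lemma relaxation_in_bounds {R : realType} (lo hi x y r c : R) :
  lo <= x <= hi -> 0 <= r -> r * c <= 1 ->
  c * (lo - x) <= y <= c * (hi - x) -> lo <= x + r * y <= hi.
Proof.
move=> /andP[lox xhi] r0 rc /andP[ly yh].
have := ler_wpM2l r0 ly; have := ler_wpM2l r0 yh; rewrite !mulrA.
by move=> ? ?; apply/andP; split; nra.
Qed.

Lemma continuous_scheme_field {R : realType} {d N : nat}
    (K : periodic_mesh R d N) (f : R -> 'rV[R]_d)
    (lam F : 'rV[R]_N -> 'I_N -> 'I_N -> R) (A : set 'rV[R]_N) :
  (forall i, {within A, continuous (fun u => scheme_rhs K f lam F u i)}) ->
  {within A, continuous (scheme_field K f lam F)}.
Proof.
by move=> crhs u; apply: cvg_row => i; apply: cvgMl_tmp; exact: crhs.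
Qed.

(** In each cell the Euler step is a relaxation with rate [h] times [d_i / |K_i|], and
    [h * C * c <= 1] is the CFL condition that prevents overshooting the bounds. *)
Lemma scheme_field_stable {R : realType} {d N : nat}
    (K : periodic_mesh R d N) (f : R -> 'rV[R]_d)
    (lam F : 'rV[R]_N -> 'I_N -> 'I_N -> R) (lo hi C c h : R) (u : 'rV[R]_N) :
  admissible N lo hi u ->
  (forall i j, j \in neighbors K i -> 0 < lam u i j) ->
  (forall i, (vol K i)^-1 * diff_coef K lam u i <= C) ->
  (forall i, c * (lo - u 0 i) <= bar_corrected K f lam F u i - u 0 i
    <= c * (hi - u 0 i)) ->
  0 <= c -> 0 <= h -> h * C * c <= 1 ->
  admissible N lo hi (u + h *: scheme_field K f lam F u).
Proof.
move=> Au lam0 dC bounds c0 h0 hCc i; rewrite !mxE /scheme_rhs !mulrA.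
have rate0 : 0 <= (vol K i)^-1 * diff_coef K lam u i.
  by rewrite mulr_ge0 ?diff_coef_ge0 ?invr_ge0 ?(ltW (vol_gt0 K i)) // => j /lam0.
apply: relaxation_in_bounds (Au i) _ _ (bounds i).
  by rewrite -mulrA mulr_ge0.
by apply: le_trans hCc; rewrite ler_wpM2r // -mulrA ler_wpM2l.
Qed.

Lemma scheme_solution_of_field {R : realType} {d N : nat}
    (K : periodic_mesh R d N) (f : R -> 'rV[R]_d)
    (lam F : 'rV[R]_N -> 'I_N -> 'I_N -> R) (w : R -> 'rV[R]_N) :
  {within `[0, +oo[, continuous w} ->
  (forall t : R, 0 < t -> is_derive t 1 w (scheme_field K f lam F (w t))) ->
  scheme_solution K f lam F (w 0) w.
Proof.
move=> cw dw; split=> // t i /dw[dwt].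
rewrite derive_mx // => /rowP/(_ i); rewrite !mxE => Dw.
split; first by move/derivable_mxP: dwt; apply.
by rewrite derive1E Dw mulVKf // gt_eqF // vol_gt0.
Qed.

Theorem mainTheorem3 (R : realType) (d N : nat) (hd : (1 <= d <= 3)%N)
  (K : periodic_mesh R d N)
  (f : R -> 'rV[R]_d) (hf : flux_C1 f)
  (lam : 'rV[R]_N -> 'I_N -> 'I_N -> R) (hlam : wave_speed_bound K f lam)
  (gamma : R) (hgamma : 0 < gamma)
  (umin umax : R) (humin_umax : umin <= umax)
  (lo hi : 'rV[R]_N -> 'I_N -> R)
  (hbounds : forall (u : 'rV[R]_N) (i : 'I_N), admissible N umin umax u ->
     [/\ umin <= lo u i <= local_min K u i,
         local_min K u i <= u 0 i <= local_max K u i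
       & local_max K u i <= hi u i <= umax])
  (F : 'rV[R]_N -> 'I_N -> 'I_N -> R)
  (hF : forall (u : 'rV[R]_N) (i : 'I_N), admissible N umin umax u ->
     (1 + gamma) * (lo u i - u 0 i)
       <= bar_corrected K f lam F u i - u 0 i
       <= (1 + gamma) * (hi u i - u 0 i))
  (hlam_bounded : exists M : R, forall (u : 'rV[R]_N) (i j : 'I_N),
     admissible N umin umax u -> j \in neighbors K i -> lam u i j <= M)
  (hrhs_continuous : forall i : 'I_N,
     {within admissible N umin umax,
       continuous (fun u : 'rV[R]_N => scheme_rhs K f lam F u i)})
  (hexists : forall u0 : 'rV[R]_N, admissible N umin umax u0 ->
     exists u : R -> 'rV[R]_N, scheme_solution K f lam F u0 u)
  (hunique : forall (u0 : 'rV[R]_N) (u v : R -> 'rV[R]_N),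
     admissible N umin umax u0 ->
     scheme_solution K f lam F u0 u -> scheme_solution K f lam F u0 v ->
     forall t : R, 0 < t -> u t = v t) :
  forall (u0 : 'rV[R]_N) (u : R -> 'rV[R]_N),
    (forall i : 'I_N, umin <= u0 0 i <= umax) ->
    scheme_solution K f lam F u0 u ->
    forall (t : R) (i : 'I_N), 0 < t -> umin <= u t 0 i <= umax.
Proof.
move=> u0 u Au0 sol t i t0.
have [M lamM] := hlam_bounded.
have [C C0 dC] := diff_coef_bounded K lam (admissible N umin umax) M lamM.
have c0 : 0 < 1 + gamma by rewrite addr_gt0.
(* The largest step is the CFL bound from [C], which dominates all [d_i / |K_i|], and the factor
   [1 + gamma] in the flux constraint. *)
have [] := @viable_ode_solution _ _ (admissible N umin umax)
  (scheme_field K f lam F) (C * (1 + gamma))^-1 _ _ _ _ u0 Au0.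
- by rewrite invr_gt0 mulr_gt0.
- exact: compact_admissible.
- exact: continuous_scheme_field.
- move=> v h Av /andP[h0 hle].
  apply: (scheme_field_stable _ _ _ _ _ _ C (1 + gamma)) => //.
  + by move=> k j /(hlam v)[].
  + by move=> k; exact: dC.
  (* The local bounds lie inside the global ones, so the flux constraint may be weakened to [umin]
     and [umax]. *)
  + move=> k; have [/andP[lo1 _] _ /andP[_ hi1]] := hbounds v k Av.
    have /andP[Fl Fr] := hF v k Av.
    apply/andP; split.
      by apply: le_trans Fl; rewrite ler_pM2l // lerD2r.
    by apply: le_trans Fr _; rewrite ler_pM2l // lerD2r.
  + exact: ltW.
  + by rewrite -mulrA -ler_pdivlMr ?mul1r // mulr_gt0.
- move=> w [w0 Aw cw dw].
  have solw : scheme_solution K f lam F u0 w.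
    by rewrite -w0; exact: scheme_solution_of_field.
  by rewrite (hunique u0 u w Au0 sol solw t t0); exact: Aw.
Qed.
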